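(* Let $k$ be an infinite field. Let $A^{\bullet}$ be a differential graded $k[x]$-algebra equipped with a differential graded multiplicative finite Kummer-type connection on $A^{\bullet}\otimes_{k[x]}k[x^{\pm1}]$, with rational, nonpositive Kummer parameters. Suppose that $A^{\bullet}$ is core-homogeneous. Then the cohomology of the singular fiber surjects onto the Picard--Lefschetz fixed points of the cohomology of the smooth fiber: there is a surjection $$H^*\left(A^{\bullet}_0\right)\twoheadrightarrow H^*\left(A^{\bullet}_{sm}\right)^T$$ of graded $k$-vector spaces.
   Context: Connections. A $k$-linear connection on a $k[x^{\pm1}]$-module $M$ is a $k$-linear map $\nabla:M\to M\otimes_{k[x^{\pm1}]}\Omega^1_{k[x^{\pm1}]/k}$ with $\nabla(mf)=(\nabla m)f+m\otimes df$. A differential graded multiplicative connection on a differential graded $k[x^{\pm1}]$-algebra consists of a connection in each degree commuting with the differential and satisfying $\nabla(ab)=(\nabla a)b+a(\nabla b)$. For $a\in k$ the Kummer module $\mathcal{K}_a$ is the free $k[x^{\pm1}]$-module on one generator $h$ with $\nabla(h)=a\,h\otimes x^{-1}dx$. A connection is finite Kummer-type if it is isomorphic to a finite direct sum of Kummer modules; it has rational nonpositive parameters if these $a$ are (images in $k$ of) nonpositive rational numbers. A Kummer basis is a $k[x^{\pm1}]$-basis $B$ with $\nabla(b)=\alpha(b)\,b\otimes x^{-1}dx$ for each $b\in B$; $\alpha(b)$ is the Kummer parameter of $b$. Standing conventions. $A^{\bullet}$ is a free $k[x]$-module with a finite homogeneous basis $B$ which is a Kummer basis for $A^{\bullet}\otimes_{k[x]}k[x^{\pm1}]$,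 with chosen rational Kummer parameters $\alpha(b)\le0$. $D$ is the least common multiple of the denominators of the $\alpha(b)$; the characteristic of $k$ does not divide $D$, and $\omega\in k$ is a fixed primitive $D$th root of unity. Fibers and $T$. For $\epsilon\in k$, $A^{\bullet}_{\epsilon}=A^{\bullet}/(x-\epsilon)$; $A^{\bullet}_0$ is the singular fiber, and $A^{\bullet}_{sm}$ is any $A^{\bullet}_{\epsilon}$ with $\epsilon\ne0$. The Picard--Lefschetz operator $T$ on $A^{\bullet}$ and on each fiber (smooth or singular) is the linear map $T(b)=\omega^r b$ for $b\in B$ with $\alpha(b)=r/D$. Equivalently it is given by the Kummer $\mathbb{Z}/D\mathbb{Z}$-grading with $b$ in degree $r$, which the differential is understood to preserve. The superscript $T$ denotes fixed points (Kummer degree zero); so $(A^{\bullet})^T$ is the $k[x]$-span of those $b\in B$ with $\alpha(b)\in\mathbb{Z}$. Core. The core of $(A^{\bullet})^T$ is the $k[x]$-submodule $\mathrm{core}((A^{\bullet})^T)\subseteq(A^{\bullet})^T[x^{-1}]$ generated by $\{x^{-\alpha(b)}b:b\in B,\ \alpha(b)\in\mathbb{Z}\}$. $A^{\bullet}$ is core-homogeneous if the differential restricts to a differential $d$ on $C=\mathrm{core}((A^{\bullet})^T)$ which is strictly compatible with the $x$-adic filtration $F^iC=x^iC$, i.e. the canonical map $\mathrm{coim}(d)\to\mathrm{im}(d)$ is an isomorphism of filtered objects (equivalently $d(F^iC)=\mathrm{im}(d)\cap F^iC$ for all $i$).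
   Formalization: In positive characteristic the surjection is asserted for all but finitely many smooth fibers, not for any smooth fiber (false for k[x][b]/(b^2) with db = x^p - 1 at x = 1); in characteristic 0 it is asserted for every smooth fiber. *)

(* Defs.v *)
From HB Require Import structures.
From mathcomp Require Import all_boot all_order all_algebra.
From mathcomp Require Import boolp classical_sets cardinality.
From mathcomp Require Import ring.

Set Implicit Arguments.
Unset Strict Implicit.
Unset Printing Implicit Defensive.

Import Order.TTheory GRing.Theory Num.Theory.
Local Open Scope ring_scope.
Local Open Scope quotient_scope.
Local Open Scope classical_set_scope.

Record submodule (R : pzRingType) (V : lmodType R) := Submodule {
  smem :> V -> Prop;
  smem0 : smem 0;
  smemP : forall (c : R) u v, smem u -> smem v -> smem (c *: u + v) }.

Section QuotMod.
Variables (R : pzRingType) (V : lmodType R) (S : submodule V).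

Definition smemb : {pred V} := fun v => `[< S v >].

Lemma smemb_closed : submod_closed smemb.
Proof.
split=> [|c u v]; rewrite !unfold_in; first exact/asboolP/smem0.
by move=> /asboolP Su /asboolP Sv; apply/asboolP/smemP.
Qed.

HB.instance Definition _ := GRing.isSubmodClosed.Build R V smemb smemb_closed.

Definition quotmod : Type := Quotient.quot smemb.

HB.instance Definition _ := GRing.Zmodule.on quotmod.

Definition cls (v : V) : quotmod := \pi_(Quotient.quot smemb) v.
Definition rep (u : quotmod) : V := repr (u : Quotient.quot smemb).

Lemma repK u : cls (rep u) = u. Proof. exact: reprK. Qed.

Lemma cls_eq v w : (cls v = cls w) <-> S (v - w).
Proof.
split=> [/eqP|Svw]; last by apply/eqP; rewrite -Quotient.idealrBE; apply/asboolP.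
by rewrite -Quotient.idealrBE => /asboolP.
Qed.

Lemma cls_rep v : S (rep (cls v) - v).
Proof. by apply/cls_eq; rewrite repK. Qed.

Lemma clsB : zmod_morphism cls.
Proof. by move=> v w; rewrite /cls !piE. Qed.

HB.instance Definition _ := GRing.isZmodMorphism.Build V quotmod cls clsB.

Definition quot_scale (c : R) (u : quotmod) : quotmod := cls (c *: rep u).

Lemma quot_scale_cls c v : quot_scale c (cls v) = cls (c *: v).
Proof.
apply/cls_eq; rewrite -scalerBr -[_ *: _]addr0.
by apply: smemP; [exact: cls_rep|exact: smem0].
Qed.

Lemma quot_scaleA a b u : quot_scale a (quot_scale b u) = quot_scale (a * b) u.
Proof. by rewrite -[u]repK !quot_scale_cls scalerA. Qed.

Lemma quot_scale1 : left_id 1 quot_scale.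
Proof. by move=> u; rewrite -[u]repK !quot_scale_cls scale1r. Qed.

Lemma quot_scaleDr : right_distributive quot_scale +%R.
Proof.
move=> a u v; rewrite -[u]repK -[v]repK -raddfD /= !quot_scale_cls.
by rewrite scalerDr raddfD.
Qed.

Lemma quot_scaleDl u : {morph quot_scale^~ u : a b / a + b}.
Proof.
by move=> a b; rewrite -[u]repK !quot_scale_cls scalerDl raddfD.
Qed.

HB.instance Definition _ := GRing.Zmodule_isLmodule.Build R quotmod
  quot_scaleA quot_scale1 quot_scaleDr quot_scaleDl.

Lemma cls_scalable : scalable cls.
Proof. by move=> c v; rewrite -quot_scale_cls. Qed.

HB.instance Definition _ := GRing.isScalable.Build R V quotmod *:%R cls
  cls_scalable.

End QuotMod.

Section Cohomology.
Variables (R : pzRingType) (V : lmodType R) (d : {linear V -> V}).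

Definition cyc : {pred V} := fun v => d v == 0.

Lemma cyc_submod : submod_closed cyc.
Proof.
split=> [|a u v]; rewrite !unfold_in ?linear0 //.
by rewrite linearP => /eqP-> /eqP->; rewrite scaler0 addr0.
Qed.

HB.instance Definition _ := GRing.isSubmodClosed.Build R V cyc cyc_submod.

Record cycles := Cycles { cycle_val :> V; cycleP : cycle_val \in cyc }.

HB.instance Definition _ := [isSub for cycle_val].
HB.instance Definition _ := [Choice of cycles by <:].
HB.instance Definition _ := [SubChoice_isSubLmodule of cycles by <:].

Lemma bnd_subproof (c : R) (z z' : cycles) :
  (exists u, val z = d u) -> (exists u, val z' = d u) ->
  exists u, val (c *: z + z') = d u.
Proof.
by move=> [u eu] [u' eu']; exists (c *: u + u'); rewrite !linearP /= eu eu'.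
Qed.

Definition bnd : submodule cycles :=
  Submodule (ex_intro _ 0 (esym (linear0 d))) bnd_subproof.

(* Total cohomology; the grading is given separately by fiber_coh_hom. *)
Definition coh : lmodType R := quotmod bnd.

Section Functoriality.
Variables (f : {linear V -> V}) (fd : forall v, f (d v) = d (f v)).

Lemma cyc_map_subproof (z : cycles) : f (val z) \in cyc.
Proof.
by rewrite unfold_in -fd; have /eqP-> := cycleP z; rewrite linear0.
Qed.

Definition cyc_map (z : cycles) : cycles := Cycles (cyc_map_subproof z).

Definition coh_map (h : coh) : coh := cls bnd (cyc_map (rep h)).

Lemma coh_mapE z : coh_map (cls bnd z) = cls bnd (cyc_map z).
Proof.
apply/cls_eq; have [u eu] := cls_rep bnd z; exists (f u).
by rewrite -fd -eu !raddfB.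
Qed.

End Functoriality.
End Cohomology.

Record dga (R : comNzRingType) := DGA {
  dga_alg :> algType R;
  dga_hom : int -> set dga_alg;
  dga_hom0 : forall n, dga_hom n 0;
  dga_homP : forall n (c : R) a b,
    dga_hom n a -> dga_hom n b -> dga_hom n (c *: a + b);
  dga_hom_gen : forall a, exists (s : seq int) (c : int -> dga_alg),
    (forall n, dga_hom n (c n)) /\ a = \sum_(n <- s) c n;
  dga_hom_free : forall (s : seq int) (c : int -> dga_alg), uniq s ->
    (forall n, dga_hom n (c n)) -> \sum_(n <- s) c n = 0 ->
    {in s, forall n, c n = 0};
  dga_hom1 : dga_hom 0 1;
  dga_homM : forall m n a b,
    dga_hom m a -> dga_hom n b -> dga_hom (m + n) (a * b);
  dga_d : {linear dga_alg -> dga_alg};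
  dga_homd : forall n a, dga_hom n a -> dga_hom (n + 1) (dga_d a);
  dga_dd : forall a, dga_d (dga_d a) = 0;
  dga_leibniz : forall n a b, dga_hom n a ->
    dga_d (a * b) = dga_d a * b + (-1) ^+ `|n|%N * (a * dga_d b) }.

Arguments dga_hom {R} _ _ _.
Arguments dga_d {R} _.

Record hom_basis (R : comNzRingType) (A : dga R) := HomBasis {
  bidx : finType;
  belt :> bidx -> A;
  bdeg : bidx -> int;
  belt_hom : forall i, dga_hom A (bdeg i) (belt i);
  belt_basis : forall a : A,
    exists! c : {ffun bidx -> R}, a = \sum_i c i *: belt i }.

Section Coordinates.
Variables (R : comNzRingType) (A : dga R) (B : hom_basis A).

Definition bcoord (a : A) : {ffun bidx B -> R} :=
  projT1 (cid (belt_basis B a)).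

Lemma bcoordE a : a = \sum_i bcoord a i *: B i.
Proof. by rewrite /bcoord; case: cid => c []. Qed.

Lemma bcoord_uniq a (c : {ffun bidx B -> R}) :
  a = \sum_i c i *: B i -> bcoord a = c.
Proof. by rewrite /bcoord; case: cid => c' [_ +] /= => /[apply]. Qed.

Lemma bcoordP c a b i : bcoord (c *: a + b) i = c * bcoord a i + bcoord b i.
Proof.
suff -> : bcoord (c *: a + b) = [ffun j => c * bcoord a j + bcoord b j].
  by rewrite ffunE.
apply: bcoord_uniq; rewrite {1}(bcoordE a) {1}(bcoordE b) scaler_sumr.
by rewrite -big_split /=; apply: eq_bigr => j _; rewrite ffunE scalerA -scalerDl.
Qed.

End Coordinates.

(* Restriction of scalars from k[x] to k. *)
Definition kres (k : fieldType) (V : lmodType {poly k}) : Type := V.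

Section Fiber.
Variables (k : fieldType) (V : lmodType {poly k}).

HB.instance Definition _ := GRing.Zmodule.on (kres V).

Definition kscale (c : k) (v : kres V) : kres V := c%:P *: (v : V).

Lemma kscaleA a b v : kscale a (kscale b v) = kscale (a * b) v.
Proof. by rewrite /kscale scalerA polyCM. Qed.

Lemma kscale1 : left_id 1 kscale.
Proof. by move=> v; rewrite /kscale scale1r. Qed.

Lemma kscaleDr : right_distributive kscale +%R.
Proof. by move=> a u v; rewrite /kscale scalerDr. Qed.

Lemma kscaleDl v : {morph kscale^~ v : a b / a + b}.
Proof. by move=> a b; rewrite /kscale polyCD scalerDl. Qed.

HB.instance Definition _ := GRing.Zmodule_isLmodule.Build k (kres V)
  kscaleA kscale1 kscaleDr kscaleDl.

Variable eps : k.

Lemma fiber_ker0 : exists u : V, 0 = ('X - eps%:P) *: u.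
Proof. by exists 0; rewrite scaler0. Qed.

Lemma fiber_kerP (c : k) (v w : kres V) :
  (exists u : V, v = ('X - eps%:P) *: u) ->
  (exists u : V, w = ('X - eps%:P) *: u) ->
  exists u : V, c *: v + w = ('X - eps%:P) *: u.
Proof.
move=> [u ->] [u' ->]; exists (c%:P *: u + u'); rewrite scalerDr.
by congr (_ + _); rewrite [LHS]scalerA scalerA mulrC.
Qed.

Definition fiber_ker : submodule (kres V) :=
  @Submodule k (kres V) [set v | exists u : V, v = ('X - eps%:P) *: u]
    fiber_ker0 fiber_kerP.

Definition fiber : lmodType k := quotmod fiber_ker.

Definition to_fiber (v : V) : fiber := cls fiber_ker v.

Lemma to_fiberK (u : fiber) : to_fiber (rep u) = u.
Proof. exact: repK. Qed.

Section FiberMap.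
Variable f : {linear V -> V}.

Definition fiber_map (u : fiber) : fiber := to_fiber (f (rep u)).

Lemma fiber_mapE v : fiber_map (to_fiber v) = to_fiber (f v).
Proof.
apply/cls_eq; have [u eu] := cls_rep fiber_ker v; exists (f u).
by rewrite -linearZ -[LHS](raddfB f); congr (f _).
Qed.

Lemma fiber_map_linear : linear fiber_map.
Proof.
move=> c u v; rewrite -[u]repK -[v]repK -linearP.
rewrite ![fiber_map _]fiber_mapE /to_fiber -linearP; congr cls.
exact: (linearP f).
Qed.

HB.instance Definition _ :=
  GRing.isLinear.Build k fiber fiber _ fiber_map fiber_map_linear.

End FiberMap.

Lemma fiber_map_comm (f g : {linear V -> V}) :
  (forall v, f (g v) = g (f v)) ->
  forall u, fiber_map f (fiber_map g u) = fiber_map g (fiber_map f u).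
Proof.
by move=> fg u; rewrite -[u]to_fiberK !fiber_mapE fg.
Qed.

End Fiber.

Section FiberCohomology.
Variables (k : fieldType) (A : dga {poly k}) (eps : k).

Definition fiber_d : {linear fiber A eps -> fiber A eps} :=
  @fiber_map k A eps (dga_d A).

Definition fiber_hom (n : int) : set (fiber A eps) :=
  to_fiber eps @` dga_hom A n.

Definition fiber_coh : lmodType k := coh fiber_d.

Definition fiber_coh_hom (n : int) : set fiber_coh :=
  [set h | exists2 z : cycles fiber_d,
             fiber_hom n (val z) & h = cls (bnd fiber_d) z].

End FiberCohomology.

Section Laurent.
Variable k : fieldType.

Local Notation K := {fraction {poly k}}.

Definition laurent_rel (f : K) (n : nat) (p : {poly k}) : Prop :=
  f * (tofrac 'X) ^+ n = tofrac p.

Definition is_laurent : {pred K} :=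
  fun f => `[< exists n p, laurent_rel f n p >].

Lemma fX_neq0 : tofrac 'X != 0 :> K.
Proof. by rewrite tofrac_eq0 polyX_eq0. Qed.

Lemma is_laurent_subring : subring_closed is_laurent.
Proof.
split=> [|f g|f g]; rewrite !unfold_in.
- by apply/asboolP; exists 0, 1; rewrite /laurent_rel expr0 mulr1 tofrac1.
- move=> /asboolP[m [p fp]] /asboolP[n [q gq]]; apply/asboolP.
  exists (m + n)%N, (p * 'X^n - q * 'X^m).
  by rewrite /laurent_rel tofracB !tofracM !tofracXn -fp -gq exprD; ring.
- move=> /asboolP[m [p fp]] /asboolP[n [q gq]]; apply/asboolP.
  by exists (m + n)%N, (p * q); rewrite /laurent_rel tofracM -fp -gq exprD mulrACA.
Qed.

HB.instance Definition _ :=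
  GRing.isSubringClosed.Build K is_laurent is_laurent_subring.

Record laurent := Laurent { laurent_val :> K; laurentP : laurent_val \in is_laurent }.

HB.instance Definition _ := [isSub for laurent_val].
HB.instance Definition _ := [Choice of laurent by <:].
HB.instance Definition _ := [SubChoice_isSubComNzRing of laurent by <:].

Lemma poly_is_laurent (p : {poly k}) : tofrac p \in is_laurent.
Proof.
by rewrite unfold_in; apply/asboolP; exists 0, p; rewrite /laurent_rel expr0 mulr1.
Qed.

Definition lpoly (p : {poly k}) : laurent := Laurent (poly_is_laurent p).

Lemma frac_is_laurent (n : nat) (p : {poly k}) :
  tofrac p / (tofrac 'X) ^+ n \in is_laurent.
Proof.
rewrite unfold_in; apply/asboolP; exists n, p.
by rewrite /laurent_rel divfK // expf_neq0 // fX_neq0.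
Qed.

(* p / x^n *)
Definition lfrac (n : nat) (p : {poly k}) : laurent :=
  Laurent (frac_is_laurent n p).

Lemma laurent_rep (f : laurent) : exists np, f = lfrac np.1 np.2.
Proof.
have := laurentP f; rewrite unfold_in => /asboolP[n [p fp]]; exists (n, p).
by apply: val_inj; rewrite /= -fp mulfK // expf_neq0 // fX_neq0.
Qed.

Definition lfrac_deriv (n : nat) (p : {poly k}) : laurent :=
  lfrac n.+1 ('X * p^`() - n%:R * p).

Definition lderiv (f : laurent) : laurent :=
  let np := projT1 (cid (laurent_rep f)) in lfrac_deriv np.1 np.2.

Lemma lfrac_eq m p n q :
  (lfrac m p = lfrac n q) <-> ('X^n * p = 'X^m * q).
Proof.
have nz i : (tofrac 'X) ^+ i != 0 :> K by rewrite expf_neq0 // fX_neq0.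
have E : (val (lfrac m p) == val (lfrac n q)) = ('X^n * p == 'X^m * q).
  rewrite /= eqr_div ?nz // -!tofracXn -!tofracM tofrac_eq.
  by rewrite mulrC [q * _]mulrC.
split=> [e|e]; first by apply/eqP; rewrite -E e.
by apply: val_inj; apply/eqP; rewrite E e.
Qed.

Lemma lderivE n p : lderiv (lfrac n p) = lfrac_deriv n p.
Proof.
rewrite /lderiv; case: cid => -[m q] /= /lfrac_eq e; apply/lfrac_eq.
have XX i : 'X * ('X^i)^`() = i%:R * 'X^i :> {poly k}.
  case: i => [|i]; first by rewrite expr0 derivC mulr0 mul0r.
  by rewrite derivXn mulrnAr -exprS mulr_natl.
have e' := congr1 (fun r : {poly k} => 'X * r^`()) e.
rewrite /= !derivM !mulrDr !mulrA !XX in e'.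
have -> : 'X^(m.+1) * ('X * p^`() - n%:R * p) =
    'X * ((m%:R * 'X^m * p + 'X * 'X^m * p^`())
          - (m%:R + n%:R) * ('X^m * p)) by rewrite exprS; ring.
by rewrite e' e exprS; ring.
Qed.

End Laurent.

Section Localization.
Variables (k : fieldType) (A : dga {poly k}) (B : hom_basis A).

(* A (x) k[x, x^-1] is free over k[x, x^-1] on the b (x) 1, b in B; u i is
   the coordinate of u on B i (x) 1. *)
Definition lext : lmodType (laurent k) := {ffun bidx B -> (laurent k)^o}.

(* a |-> a (x) 1 *)
Definition to_lext (a : A) : lext := [ffun i => lpoly (bcoord B a i)].

Definition lext_hom (n : int) : set lext :=
  [set u | forall i, u i != 0 -> bdeg i = n].

Definition lext_d (u : lext) : lext := \sum_i u i *: to_lext (dga_d A (B i)).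

Definition lext_mul (u v : lext) : lext :=
  \sum_i \sum_j (u i * v j) *: to_lext (B i * B j).

(* Omega^1 of k[x, x^-1] over k is free on dx, so a map
   M -> M (x) Omega^1 is written u |-> nabla u (x) dx with nabla : M -> M.
   Under this identification u (x) df is f' u. *)
Record connection (nabla : lext -> lext) : Prop := Connection {
  connection_linear : forall (c : k) u v,
    nabla (lpoly c%:P *: u + v) = lpoly c%:P *: nabla u + nabla v;
  connection_leibniz : forall (f : laurent k) u,
    nabla (f *: u) = f *: nabla u + lderiv f *: u }.

Record dg_mult_connection (nabla : lext -> lext) : Prop := DgMultConnection {
  dgmc_connection : connection nabla;
  dgmc_hom : forall n u, lext_hom n u -> lext_hom n (nabla u);
  dgmc_d : forall u, nabla (lext_d u) = lext_d (nabla u);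
  dgmc_mul : forall u v,
    nabla (lext_mul u v) = lext_mul (nabla u) v + lext_mul u (nabla v) }.

(* B is a Kummer basis with parameters alpha:
   nabla b = alpha(b) b (x) x^-1 dx. *)
Definition kummer_basis (nabla : lext -> lext) (alpha : bidx B -> rat) : Prop :=
  forall i, nabla (to_lext (B i)) =
    lfrac 1 (ratr (alpha i) : k)%:P *: to_lext (B i).

End Localization.

Section PicardLefschetz.
Variables (k : fieldType) (A : dga {poly k}) (B : hom_basis A).
Variable alpha : bidx B -> rat.

Definition kummer_den : nat := \big[lcmn/1%N]_i `|denq (alpha i)|%N.

(* The integer r with alpha(b) = r / D. *)
Definition kummer_deg (i : bidx B) : int :=
  numq (alpha i * kummer_den%:R).

Lemma kummer_degE i : alpha i = (kummer_deg i)%:~R / kummer_den%:R.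
Proof.
have den_dvd : (`|denq (alpha i)| %| kummer_den)%N.
  by rewrite /kummer_den (bigD1 i) //= dvdn_lcml.
have den_gt0 : (0 < kummer_den)%N.
  rewrite /kummer_den; elim/big_ind: _ => // [m n m0 n0|j _].
    by rewrite lcmn_gt0 m0.
  by rewrite absz_gt0 denq_neq0.
have den_neq0 : kummer_den%:R != 0 :> rat by rewrite pnatr_eq0 -lt0n.
apply: (canRL (mulfK den_neq0)); rewrite /kummer_deg numqK //.
case/dvdnP: den_dvd => m ->; rewrite natrM mulrCA natr_absz.
rewrite gtr0_norm ?denq_gt0 // -numqE.
by rewrite rpredM ?natr_int ?rpred_int.
Qed.

Definition kummer_hom (r : int) : set A :=
  [set a | forall i, bcoord B a i != 0 ->
             (kummer_deg i = r %[mod kummer_den%:Z])%Z].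

Definition d_preserves_kummer : Prop :=
  forall r a, kummer_hom r a -> kummer_hom r (dga_d A a).

Variable omega : k.

Definition pl (a : A) : A :=
  \sum_i ((omega ^ kummer_deg i)%:P * bcoord B a i) *: B i.

Lemma pl_linear : linear pl.
Proof.
move=> c a b; rewrite /pl scaler_sumr -big_split; apply: eq_bigr => i _ /=.
by rewrite bcoordP mulrDr scalerDl scalerA mulrCA.
Qed.

HB.instance Definition _ := GRing.isLinear.Build {poly k} A A _ pl pl_linear.

Hypothesis omegaP : kummer_den.-primitive_root omega.
Hypothesis dP : d_preserves_kummer.

Lemma pl_kummer_hom r a : kummer_hom r a -> pl a = (omega ^ r)%:P *: a.
Proof.
move=> ra; rewrite {2}(bcoordE B a) scaler_sumr /pl.
apply: eq_bigr => i _; rewrite scalerA.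
have [->|/ra e] := eqVneq (bcoord B a i) 0; first by rewrite !mulr0.
have w0 : omega != 0.
  apply/eqP => w0; have := prim_expr_order omegaP; rewrite w0.
  by move/eqP; rewrite expr0n eqn0Ngt (prim_order_gt0 omegaP) eq_sym oner_eq0.
congr (_%:P * _ *: _).
rewrite (divz_eq (kummer_deg i) kummer_den) (divz_eq r kummer_den) e.
by rewrite !expfzDr // ![(_ * _%:Z)%R]mulrC -!exprz_exp
  -!exprnP !(prim_expr_order omegaP) !exp1rz.
Qed.

Lemma kummer_hom_belt i : kummer_hom (kummer_deg i) (B i).
Proof.
rewrite /kummer_hom /=.
rewrite (@bcoord_uniq _ _ _ _ [ffun j => (j == i)%:R]).
  by move=> j; rewrite ffunE; case: (j =P i) => [->|_] //; rewrite eqxx.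
rewrite (bigD1 i) //= ffunE eqxx scale1r big1 ?addr0 // => j /negbTE ji.
by rewrite ffunE ji scale0r.
Qed.

Lemma pl_d a : pl (dga_d A a) = dga_d A (pl a).
Proof.
rewrite {1}(bcoordE B a) linear_sum /= linear_sum /= /pl linear_sum /=.
apply: eq_bigr => i _; rewrite -/(pl _) linearZ linearZ /= linearZ /=.
rewrite (pl_kummer_hom (dP (@kummer_hom_belt i))) scalerA.
by rewrite mulrC.
Qed.

Variable eps : k.

Definition fiber_pl : {linear fiber A eps -> fiber A eps} :=
  @fiber_map k A eps pl.

Lemma fiber_pl_d u : fiber_pl (fiber_d A eps u) = fiber_d A eps (fiber_pl u).
Proof. exact: (fiber_map_comm pl_d). Qed.

Definition coh_pl : fiber_coh A eps -> fiber_coh A eps := coh_map fiber_pl_d.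

Definition coh_fixed : set (fiber_coh A eps) := [set h | coh_pl h = h].

Definition surjects_onto_fixed : Prop :=
  exists phi : {linear fiber_coh A 0 -> fiber_coh A eps},
    (forall n h, fiber_coh_hom n h -> fiber_coh_hom n (phi h)) /\
    phi @` [set: fiber_coh A 0] = coh_fixed.

End PicardLefschetz.

Section Core.
Variables (k : fieldType) (A : dga {poly k}) (B : hom_basis A).
Variable alpha : bidx B -> rat.

(* The k[x]-span of the x^(- alpha(b)) b with alpha(b) an integer.  Since
   alpha <= 0 these generators lie in A, which embeds in A[x^-1] because it is
   free; so there is no need to invert x. *)
Definition core : set A :=
  [set a | exists c : bidx B -> {poly k},
     a = \sum_(i | alpha i \is a Num.int)
           c i *: ('X^(`|numq (alpha i)|%N) *: B i)].

Definition core_filt (n : nat) : set A := [set 'X^n *: a | a in core].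

(* Strictness: d(F^n C) = im(d) `&` F^n C, with d the differential of C. *)
Definition core_homogeneous : Prop :=
  (forall a, core a -> core (dga_d A a)) /\
  (forall n, dga_d A @` core_filt n = (dga_d A @` core) `&` core_filt n).

End Core.

(* Main.v *)
(* The cohomology of a fiber can only jump up at eps = 0: in the basis B the
   differential of the fiber at eps is the evaluation at eps of a polynomial
   matrix, and the rank of each graded piece of that matrix is lower
   semicontinuous in eps.  Hence for generic eps there are graded linear maps of
   the chain spaces which carry cycles to cycles, kill boundaries, and hit every
   class of the fiber at eps; composing with the projector onto the
   T-eigenvalue 1, which commutes with the differential, gives the surjection.
   In characteristic 0, compatibility of d with nabla says that each entry p of
   the matrix satisfies x p' = (alpha(b) - alpha(b')) p, so p is a multiple of
   x^(alpha(b) - alpha(b')); all fibers over eps <> 0 are then isomorphic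
   complexes, and every such eps is generic. *)
From HB Require Import structures.
Require Import Defs.
From mathcomp Require Import all_boot all_order all_algebra.
From mathcomp Require Import boolp classical_sets cardinality.
From mathcomp Require Import ring zify.
Import Order.TTheory GRing.Theory Num.Theory.
Local Open Scope ring_scope.
Local Open Scope classical_set_scope.

Set Implicit Arguments.
Unset Strict Implicit.
Unset Printing Implicit Defensive.

(** * Linear algebra: rank under specialization and maps of subquotients *)

Lemma finite_root_set (k : fieldType) (q : {poly k}) :
  q != 0 -> finite_set [set e | root q e].
Proof.
move=> q0; apply: contrapT => /(infinite_set_fset (size q))[S Sq].
apply/negP; rewrite -ltnNge.
apply: max_poly_roots => //; last exact: finmap.fset_uniq.
by apply/allP => e eS; apply: Sq.
Qed.

(** Constant matrices [L] and [R] cut an identity block of size [r] out of the matrix at [a]. The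
    polynomial [q], the determinant of the same cut of [M], takes the value 1 at [a]; wherever it
    does not vanish, the rank is still at least [r]. *)
Lemma mxrank_specialization (k : fieldType) m n (M : 'M[{poly k}]_(m, n)) a :
  exists2 q : {poly k}, q != 0 & forall e, ~~ root q e ->
    (\rank (map_mx (horner_eval a) M) <= \rank (map_mx (horner_eval e) M))%N.
Proof.
set Ma := map_mx _ M; set r := \rank Ma.
have [L LE] : exists L, L *m col_base Ma = 1%:M.
  exact/row_fullP/col_base_full.
have [R RE] : exists R, row_base Ma *m R = 1%:M.
  exact/row_freeP/row_base_free.
have LMR : L *m Ma *m R = 1%:M.
  transitivity (L *m (col_base Ma *m row_base Ma) *m R).
    by rewrite mulmx_base.
  by rewrite (mulmxA L) LE mul1mx RE.
pose q := \det (map_mx polyC L *m M *m map_mx polyC R).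
have qE e : q.[e] = \det (L *m map_mx (horner_eval e) M *m R).
  rewrite -[LHS]/(horner_eval e q) -det_map_mx !map_mxM -!map_mx_comp.
  by congr (\det (_ *m _ *m _)); apply/matrixP => i j;
    rewrite !mxE /= /horner_eval hornerC.
exists q.
  apply: contra_eq_neq (qE a) => ->; rewrite LMR det1 horner0 eq_sym.
  exact: oner_neq0.
move=> e; rewrite /root qE -unitfE -unitmxE -row_full_unit /row_full => /eqP rk.
rewrite -[r]rk.
exact: leq_trans (mxrankM_maxl _ _) (mxrankM_maxr _ _).
Qed.

(** The rank hypothesis is dim Z1/B1 <= dim Z0/B0, written without subtraction. A complement of [B0]
    in [Z0] therefore maps onto a complement of [B1] in [Z1], and [F] is such a map extended by zero
    on [B0]. *)
Lemma subquotient_surjection (k : fieldType) N (Z0 B0 Z1 B1 : 'M[k]_N) :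
  (B0 <= Z0)%MS -> (B1 <= Z1)%MS ->
  (\rank Z1 + \rank B0 <= \rank Z0 + \rank B1)%N ->
  exists F : 'M[k]_N,
    [/\ B0 *m F = 0, (Z0 *m F <= Z1)%MS & (Z1 <= Z0 *m F + B1)%MS].
Proof.
move=> sB0 sB1 le_rank.
set W0 := (Z0 :\: B0)%MS; set W1 := (Z1 :\: B1)%MS.
have leW : (\rank W1 <= \rank W0)%N.
  have := mxrank_cap_compl Z0 B0; have := mxrank_cap_compl Z1 B1.
  rewrite (capmx_idPr sB0) (capmx_idPr sB1) -/W0 -/W1.
  by move: le_rank; lia.
have dW0 : (W0 :&: B0)%MS = 0 by exact: capmx_diff.
(* From left to right: project to [W0] along [B0], take coordinates in a basis of [W0], keep the
   first [\rank W1] of them, and read these in a basis of [W1]. *)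
pose F := proj_mx W0 B0 *m pinvmx (row_base W0) *m
  (pid_mx (\rank W1) : 'M_(\rank W0, \rank W1)) *m row_base W1.
have W1F : (W1 <= Z0 *m F)%MS.
  (* [X] consists of the first [\rank W1] basis rows of [W0]; [F] sends them to the basis of
     [W1]. *)
  have [X XW XE] : exists2 X : 'M_(\rank W1, N), (X <= W0)%MS &
      X *m pinvmx (row_base W0) = pid_mx (\rank W1).
    exists (pid_mx (\rank W1) *m row_base W0).
      by rewrite (submx_trans (submxMl _ _)) ?eq_row_base.
    by rewrite mulmxKp // row_base_free.
  have -> : (W1 <= Z0 *m F)%MS = (X *m F <= Z0 *m F)%MS.
    rewrite -eq_row_base; congr (_ <= _)%MS.
    rewrite /F 3!mulmxA proj_mx_id // XE pid_mx_id //.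
    by rewrite pid_mx_1 mul1mx.
  by apply: submxMr; apply: submx_trans XW _; apply: diffmxSl.
exists F; split.
- by rewrite /F 3!mulmxA proj_mx_0 // !mul0mx.
- rewrite /F 3!mulmxA; apply: submx_trans (submxMl _ _) _.
  by rewrite eq_row_base diffmxSl.
- rewrite -(addsmx_diff_cap_eq Z1 B1); apply: addsmxS => //.
  exact: capmxSr.
Qed.

(** * Graded matrices and degreewise maps of complexes *)

Section GradedMatrices.
Variables (N : nat) (deg : 'I_N -> int).

Definition degproj (R : pzRingType) (n : int) : 'M[R]_N :=
  diag_mx (\row_i (deg i == n)%:R).

(** Matrices act on row vectors from the right, so rows index the source and columns the target:
    this is homogeneity of degree [s]. *)
Definition homog_mx (R : pzRingType) (s : int) (M : 'M[R]_N) :=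
  forall i j, M i j != 0 -> deg j = deg i + s.

Lemma degproj_comm (R : comPzRingType) n s (M : 'M[R]_N) :
  homog_mx s M -> degproj R n *m M = M *m degproj R (n + s).
Proof.
move=> hM; apply/matrixP => i j; rewrite mul_diag_mx mul_mx_diag !mxE mulrC.
have [->|/hM ->] := eqVneq (M i j) 0; first by rewrite !mul0r.
by rewrite (inj_eq (addIr s)).
Qed.

Lemma map_degproj (R S : pzRingType) (f : {rmorphism R -> S}) n :
  map_mx f (degproj R n) = degproj S n.
Proof.
by apply/matrixP => i j; rewrite !mxE rmorphMn rmorph_nat.
Qed.

Variable k : fieldType.
Local Notation P := (degproj k).

Lemma degproj_idem n : P n *m P n = P n.
Proof.
apply/matrixP => i j; rewrite mul_diag_mx !mxE.
by have [_|] := eqVneq (deg i) n; rewrite ?mul1r // mul0r mul0rn.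
Qed.

Lemma sub_degproj m n (A : 'M[k]_(m, N)) : (A <= P n)%MS = (A *m P n == A).
Proof.
apply/idP/eqP => [/submxP[X ->]|<-]; last exact: submxMl.
by rewrite -mulmxA degproj_idem.
Qed.

Lemma eq_degproj (v w : 'rV[k]_N) : (forall n, v *m P n = w *m P n) -> v = w.
Proof.
move=> vw; apply/rowP => j; have /rowP/(_ j) := vw (deg j).
by rewrite !mul_mx_diag !mxE eqxx !mulr1.
Qed.

Lemma degproj_glue (v : int -> 'rV[k]_N) :
  exists w : 'rV[k]_N, forall n, w *m P n = v n *m P n.
Proof.
exists (\row_j v (deg j) 0 j) => n; apply/rowP => j.
rewrite !mul_mx_diag !mxE.
by have [->|] := eqVneq (deg j) n; rewrite ?mulr0.
Qed.

(** The rank of [P n *m M] is the rank of the differential leaving degree n. Passing from [M0] to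
    [M1], cycles can only shrink and boundaries only grow, so each graded piece of the cohomology of
    [M0] is at least as large as that of [M1]. The resulting [F] need not commute with the
    differentials, but it kills boundaries and preserves cycles, which is enough on cohomology. *)
Lemma graded_chain_surjection (M0 M1 : 'M[k]_N) :
  homog_mx 1 M0 -> homog_mx 1 M1 -> M0 *m M0 = 0 -> M1 *m M1 = 0 ->
  (forall n, \rank (P n *m M0) <= \rank (P n *m M1))%N ->
  exists F : 'M[k]_N,
  [/\ homog_mx 0 F, M0 *m F = 0,
      forall z : 'rV_N, z *m M0 = 0 -> z *m F *m M1 = 0
    & forall z : 'rV_N, z *m M1 = 0 ->
        exists z0 u : 'rV_N, z0 *m M0 = 0 /\ z = z0 *m F + u *m M1].
Proof.
move=> h0 h1 dd0 dd1 le_rank.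
have PM M : homog_mx 1 M -> forall n, P (n - 1) *m M = M *m P n.
  by move=> hM n; rewrite (degproj_comm _ hM) subrK.
pose Z (M : 'M[k]_N) n := (P n :&: kermx M)%MS.
pose Bd (M : 'M[k]_N) n := P (n - 1) *m M.
have sBZ M n : homog_mx 1 M -> M *m M = 0 -> (Bd M n <= Z M n)%MS.
  move=> hM dd; rewrite sub_capmx; apply/andP; split.
    by rewrite /Bd PM // submxMl.
  by apply/sub_kermxP; rewrite /Bd -mulmxA dd mulmx0.
have rkZ M n : (\rank (P n *m M) + \rank (Z M n) = \rank (P n))%N.
  exact: mxrank_mul_ker.
have /choice[Fn FnP] : forall n, exists F : 'M[k]_N, [/\ Bd M0 n *m F = 0,
    (Z M0 n *m F <= Z M1 n)%MS & (Z M1 n <= Z M0 n *m F + Bd M1 n)%MS].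
  move=> n; apply: subquotient_surjection; try exact: sBZ.
  (* Degree n bounds the cycles through rank-nullity; degree n - 1 bounds the boundaries that arrive
     in degree n. *)
  have := le_rank n; have := le_rank (n - 1).
  have := rkZ M0 n; have := rkZ M1 n; rewrite /Bd; lia.
(* The rows of degree n are taken from [Fn n], with the entries outside degree n cut off to make [F]
   homogeneous. *)
pose F : 'M[k]_N := \matrix_(i, j) (Fn (deg i) i j *+ (deg j == deg i)).
have hF : homog_mx 0 F.
  move=> i j; rewrite mxE addr0; case: (deg j =P deg i) => // _.
  by rewrite eqxx.
have PF n : P n *m F = F *m P n by rewrite (degproj_comm _ hF) addr0.
have PFn n : P n *m F = P n *m Fn n *m P n.
  apply/matrixP => i j; rewrite mul_mx_diag !mul_diag_mx !mxE.
  have [->|] := eqVneq (deg i) n; last by rewrite !mul0r.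
  by rewrite !mul1r mulr_natr.
(* On cycles of degree n the cut-off changes nothing, since [Fn n] already sends them into degree
   n. *)
have ZF m n (v : 'M_(m, N)) : (v <= Z M0 n)%MS -> v *m F = v *m Fn n.
  move=> vZ; have := vZ; rewrite sub_capmx sub_degproj => /andP[/eqP vP _].
  rewrite -{1}vP -mulmxA PFn !mulmxA vP; apply/eqP; rewrite -sub_degproj.
  have [_ ZZ _] := FnP n.
  by apply: submx_trans (submxMr _ vZ) (submx_trans ZZ _); apply: capmxSl.
have ZP M (v : 'rV_N) n : homog_mx 1 M -> v *m M = 0 -> (v *m P n <= Z M n)%MS.
  move=> hM vM; rewrite sub_capmx submxMl; apply/sub_kermxP.
  by rewrite -mulmxA (degproj_comm _ hM) mulmxA vM mul0mx.
exists F; split=> //.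
- apply/row_matrixP => i; rewrite row0 rowE mulmxA; apply: eq_degproj => n.
  rewrite mul0mx -(mulmxA _ F) -PF mulmxA -(mulmxA _ M0) -PM //.
  rewrite -(mulmxA _ _ F) -/(Bd M0 n) (ZF _ n) ?sBZ //.
  by have [FB _ _] := FnP n; rewrite FB mulmx0.
- move=> z z0; apply: eq_degproj => n.
  rewrite -mulmxA -PM // mulmxA -[X in X *m M1]mulmxA -PF mulmxA.
  rewrite (ZF _ (n - 1)) ?ZP // mul0mx; apply/sub_kermxP.
  have [_ ZZ _] := FnP (n - 1).
  apply: submx_trans (submxMr _ (ZP _ _ _ h0 z0)) _.
  by apply: submx_trans ZZ _; apply: capmxSr.
- move=> z z1.
  have /choice[zu zuP] : forall n, exists zu : 'rV[k]_N * 'rV[k]_N,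
      (zu.1 <= Z M0 n)%MS /\ z *m P n = zu.1 *m F + zu.2 *m P (n - 1) *m M1.
    move=> n; have [_ _ ZZ] := FnP n.
    have /sub_addsmxP[[a b] /= ->] := submx_trans (ZP _ _ n h1 z1) ZZ.
    exists (a *m Z M0 n, b); split; first exact: submxMl.
    by rewrite (ZF _ n) ?submxMl // /Bd !mulmxA.
  have [z0 z0E] := degproj_glue (fun n => (zu n).1).
  (* The shift by one: a boundary in degree n + 1 has its primitive in degree n. *)
  have [u uE] := degproj_glue (fun n => (zu (n + 1)).2).
  have z0P n : z0 *m P n = (zu n).1.
    rewrite z0E; apply/eqP; rewrite -sub_degproj.
    by apply: submx_trans (zuP n).1 _; apply: capmxSl.
  exists z0, u; split; apply: eq_degproj => n.
    rewrite -mulmxA -PM // mulmxA z0P mul0mx; apply/sub_kermxP.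
    by apply: submx_trans (zuP _).1 _; apply: capmxSr.
  rewrite mulmxDl -[z0 *m F *m _]mulmxA -PF -[u *m M1 *m _]mulmxA -PM //.
  by rewrite !mulmxA z0P uE subrK; exact: (zuP n).2.
Qed.

End GradedMatrices.

(** * Maps induced on cohomology *)

(** Commutation of [f] with the differentials is replaced by the weaker conditions on cycles and
    boundaries, because the maps built from [graded_chain_surjection] satisfy only these. *)
Lemma coh_functor (R : pzRingType) (V W : lmodType R)
    (d : {linear V -> V}) (d' : {linear W -> W}) (f : {linear V -> W}) :
  (forall v, d v = 0 -> d' (f v) = 0) ->
  (forall v, exists w, f (d v) = d' w) ->
  exists phi : {linear coh d -> coh d'},
    forall (z : cycles d) (z' : cycles d'), val z' = f (val z) ->
      phi (cls (bnd d) z) = cls (bnd d') z'.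
Proof.
move=> fcyc fbnd.
have fz (z : cycles d) : f (val z) \in cyc d'.
  by rewrite unfold_in fcyc //; apply/eqP; exact: cycleP.
pose F (h : coh d) : coh d' := cls (bnd d') (Cycles (fz (rep h))).
have FE (z : cycles d) (z' : cycles d') :
    val z' = f (val z) -> F (cls (bnd d) z) = cls (bnd d') z'.
  move=> zz'; apply/cls_eq => /=; have [u eu] := cls_rep (bnd d) z.
  have [w ew] := fbnd u; exists w.
  by rewrite -ew -eu !raddfB /= zz'.
have Flin : linear F.
  move=> c x y; rewrite -{1}[x]repK -{1}[y]repK -linearP.
  rewrite (FE _ (c *: Cycles (fz (rep x)) + Cycles (fz (rep y)))).
    by rewrite linearP.
  by rewrite !linearP.
pose phi : {linear coh d -> coh d'} :=
  HB.pack F (GRing.isLinear.Build R (coh d) (coh d') _ F Flin).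
by exists phi.
Qed.

(** * Coordinates on the algebra and on its fibers *)

Section BasisDegree.
Variables (R : comNzRingType) (A : dga R) (B : hom_basis A).

Lemma dga_hom_sum n (I : Type) (r : seq I) (Q : pred I) (F : I -> A) :
  (forall i, Q i -> dga_hom A n (F i)) -> dga_hom A n (\sum_(i <- r | Q i) F i).
Proof.
move=> nF; elim/big_ind: _ => //; first exact: dga_hom0.
by move=> x y nx ny; rewrite -[x]scale1r; exact: dga_homP.
Qed.

Lemma dga_homZ n (c : R) (a : A) : dga_hom A n a -> dga_hom A n (c *: a).
Proof. by move=> na; rewrite -[_ *: _]addr0; apply: dga_homP (dga_hom0 _ _). Qed.

Lemma bcoord_lin (c : {ffun bidx B -> R}) : bcoord B (\sum_i c i *: B i) = c.
Proof. exact: bcoord_uniq. Qed.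

(** If [a] is homogeneous of degree n, grouping its expansion by degree and subtracting [a] in
    degree n gives homogeneous terms with sum zero. Directness of the grading kills the group of
    every other degree, and uniqueness of coordinates then kills each coefficient in it. *)
Lemma bcoord_hom n (a : A) :
  (forall i, bcoord B a i != 0 -> bdeg i = n) <-> dga_hom A n a.
Proof.
split=> [na|na i].
  rewrite (bcoordE B a); apply: dga_hom_sum => i _.
  have [->|/na <-] := eqVneq (bcoord B a i) 0.
    by rewrite scale0r; exact: dga_hom0.
  exact/dga_homZ/belt_hom.
apply: contra_neqP => /eqP ni.
pose c m := \sum_(j | bdeg j == m) bcoord B a j *: B j - a *+ (m == n).
have c_hom m : dga_hom A m (c m).
  rewrite /c addrC -scaleN1r; apply: dga_homP; last first.
    by apply: dga_hom_sum => j /eqP <-; exact/dga_homZ/belt_hom.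
  by case: eqP => [->|_] //; exact: dga_hom0.
(* The degree n is added by hand, as it need not be the degree of any basis element. *)
pose s := undup (n :: [seq bdeg j | j <- enum (bidx B)]).
have in_s (j : bidx B) : bdeg j \in s.
  rewrite mem_undup inE; apply/orP; right.
  by apply: map_f; rewrite mem_enum.
have n_s : n \in s by rewrite mem_undup inE eqxx.
have sum0 : \sum_(m <- s) c m = 0.
  rewrite sumrB [X in _ - X](bigD1_seq n) ?undup_uniq //= eqxx mulr1n.
  rewrite [X in _ - (_ + X)]big1 => [|m /negbTE ->]; last by rewrite mulr0n.
  rewrite addr0 {2}(bcoordE B a); apply/eqP; rewrite subr_eq0; apply/eqP.
  rewrite (exchange_big_dep xpredT) //=; apply: eq_bigr => j _.
  rewrite big_mkcond (bigD1_seq (bdeg j)) ?undup_uniq //= eqxx.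
  by rewrite big1 ?addr0 // => m /negbTE; rewrite eq_sym => ->.
have /(_ (bdeg i) (in_s i)) := dga_hom_free (undup_uniq _) c_hom sum0.
rewrite /c (negbTE ni) subr0 => ci0.
have := bcoord_lin [ffun j => bcoord B a j *+ (bdeg j == bdeg i)].
have -> : \sum_j [ffun j => bcoord B a j *+ (bdeg j == bdeg i)] j *: B j = 0.
  rewrite -[RHS]ci0 [RHS]big_mkcond; apply: eq_bigr => j _ /=; rewrite ffunE.
  by case: eqP => _; rewrite ?mulr1n // mulr0n scale0r.
have -> : 0 = \sum_j [ffun=> 0 : R] j *: B j.
  by rewrite big1 // => j _; rewrite ffunE scale0r.
rewrite bcoord_lin => /ffunP/(_ i); rewrite !ffunE eqxx mulr1n => <-.
by [].
Qed.

End BasisDegree.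

Section FiberCoordinates.
Variables (k : fieldType) (A : dga {poly k}) (B : hom_basis A).
Local Notation N := #|bidx B|.

Lemma sum_enum_val (V : nmodType) (F : bidx B -> V) :
  \sum_i F i = \sum_(j < N) F (enum_val j).
Proof. by rewrite (reindex _ (onW_bij _ (@enum_val_bij (bidx B)))). Qed.

Definition coord_at (eps : k) (a : A) : 'rV[k]_N :=
  \row_j (bcoord B a (enum_val j)).[eps].

Lemma coord_atP eps (p : {poly k}) (a b : A) :
  coord_at eps (p *: a + b) = p.[eps] *: coord_at eps a + coord_at eps b.
Proof. by apply/rowP => j; rewrite !mxE bcoordP hornerD hornerM. Qed.

Lemma bcoord0 i : bcoord B 0 i = 0.
Proof.
rewrite (bcoord_uniq (c := [ffun=> 0])) ?ffunE //.
by rewrite big1 // => j _; rewrite ffunE scale0r.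
Qed.

Lemma coord_at0 eps : coord_at eps 0 = 0.
Proof. by apply/rowP => j; rewrite !mxE bcoord0 horner0. Qed.

Lemma coord_atZ eps p a : coord_at eps (p *: a) = p.[eps] *: coord_at eps a.
Proof. by rewrite -[p *: a]addr0 coord_atP coord_at0 addr0. Qed.

Lemma coord_atD eps a b : coord_at eps (a + b) = coord_at eps a + coord_at eps b.
Proof. by rewrite -[a]scale1r coord_atP hornerC !scale1r. Qed.

Lemma coord_at_sum eps (I : Type) (r : seq I) (F : I -> A) :
  coord_at eps (\sum_(i <- r) F i) = \sum_(i <- r) coord_at eps (F i).
Proof.
elim: r => [|i r IH]; first by rewrite !big_nil coord_at0.
by rewrite !big_cons coord_atD IH.
Qed.

(** This is the factor theorem in each coordinate. It identifies the fiber at [eps] with the space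
    of row vectors, so that fibers at different points can be compared. *)
Lemma coord_at_eq0 eps a :
  coord_at eps a = 0 <-> exists u : A, a = ('X - eps%:P) *: u.
Proof.
split=> [/rowP a0|[u ->]]; last first.
  by rewrite coord_atZ !hornerE subrr scale0r.
have /choice[q qE] i : exists q, bcoord B a i = q * ('X - eps%:P).
  apply/factor_theorem/eqP.
  by have := a0 (enum_rank i); rewrite !mxE enum_rankK.
exists (\sum_i q i *: B i); rewrite {1}(bcoordE B a) scaler_sumr.
by apply: eq_bigr => i _; rewrite qE scalerA mulrC.
Qed.

Definition fiber_coord (eps : k) (u : fiber A eps) : 'rV[k]_N :=
  coord_at eps (rep u).

Definition fiber_of_coord (eps : k) (v : 'rV[k]_N) : fiber A eps :=
  to_fiber eps (\sum_j (v 0 j)%:P *: B (enum_val j)).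

Lemma to_fiber_eq eps (a b : A) :
  to_fiber eps a = to_fiber eps b <-> coord_at eps a = coord_at eps b.
Proof.
have sub : coord_at eps (a - b) = coord_at eps a - coord_at eps b.
  by rewrite addrC -scaleN1r coord_atP hornerN hornerC scaleN1r addrC.
split=> [/cls_eq /= /coord_at_eq0|ab].
  by rewrite sub => /eqP; rewrite subr_eq0 => /eqP.
by apply/cls_eq/coord_at_eq0; rewrite sub ab subrr.
Qed.

Lemma fiber_coordE eps a : fiber_coord (to_fiber eps a) = coord_at eps a.
Proof. exact/to_fiber_eq/to_fiberK. Qed.

Lemma fiber_coordK eps : cancel (@fiber_of_coord eps) (@fiber_coord eps).
Proof.
move=> v; rewrite fiber_coordE; apply/rowP => j; rewrite mxE.
rewrite (bcoord_uniq (c := [ffun i => (v 0 (enum_rank i))%:P])).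
  by rewrite ffunE enum_valK hornerC.
by rewrite sum_enum_val; apply: eq_bigr => i _; rewrite ffunE enum_valK.
Qed.

Lemma fiber_coord_inj eps : injective (@fiber_coord eps).
Proof.
move=> u v uv; rewrite -[u]to_fiberK -[v]to_fiberK; exact/to_fiber_eq.
Qed.

Lemma fiber_of_coordK eps : cancel (@fiber_coord eps) (@fiber_of_coord eps).
Proof. by move=> u; apply: fiber_coord_inj; rewrite fiber_coordK. Qed.

Lemma fiber_coord_linear eps : linear (@fiber_coord eps).
Proof.
move=> c u v; rewrite -{1}[u]to_fiberK -{1}[v]to_fiberK /to_fiber -linearP.
rewrite [LHS]fiber_coordE.
by rewrite -[in RHS](hornerC c eps) -coord_atP.
Qed.

HB.instance Definition _ eps :=
  GRing.isLinear.Build k (fiber A eps) 'rV[k]_N _ (@fiber_coord eps)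
    (@fiber_coord_linear eps).

Lemma fiber_of_coord_linear eps : linear (@fiber_of_coord eps).
Proof.
by move=> c u v; apply: fiber_coord_inj; rewrite linearP /= !fiber_coordK.
Qed.

HB.instance Definition _ eps :=
  GRing.isLinear.Build k 'rV[k]_N (fiber A eps) _ (@fiber_of_coord eps)
    (@fiber_of_coord_linear eps).

Definition basis_mx (f : A -> A) : 'M[{poly k}]_N :=
  \matrix_(i, j) bcoord B (f (B (enum_val i))) (enum_val j).

Lemma fiber_coord_map eps (f : {linear A -> A}) (u : fiber A eps) :
  fiber_coord (fiber_map f u) =
    fiber_coord u *m map_mx (horner_eval eps) (basis_mx f).
Proof.
rewrite -[u]to_fiberK fiber_mapE !fiber_coordE; set a := rep u.
rewrite {1}(bcoordE B a) linear_sum sum_enum_val coord_at_sum.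
apply/rowP => j; rewrite summxE !mxE; apply: eq_bigr => i _.
by rewrite linearZ coord_atZ !mxE.
Qed.

Definition mdeg (j : 'I_N) : int := bdeg (enum_val j : bidx B).

Lemma basis_mx_d_homog : homog_mx mdeg 1 (basis_mx (dga_d A)).
Proof.
move=> i j; rewrite mxE; apply: (bcoord_hom B _ _).2.
exact/dga_homd/belt_hom.
Qed.

Lemma homog_mx_horner s eps (M : 'M[{poly k}]_N) :
  homog_mx mdeg s M -> homog_mx mdeg s (map_mx (horner_eval eps) M).
Proof.
move=> hM i j; rewrite mxE => Mij; apply: hM.
by apply: contraNneq Mij => ->; rewrite rmorph0.
Qed.

(** A homogeneous element of the fiber is only known to have some homogeneous lift; conversely, the
    lift with constant coefficients is homogeneous when the coordinates are supported in degree
    n. *)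
Lemma fiber_homE eps n (u : fiber A eps) :
  fiber_hom n u <-> (forall j, fiber_coord u 0 j != 0 -> mdeg j = n).
Proof.
split=> [[a na <-] j|nu].
  rewrite fiber_coordE mxE => aj; apply: ((bcoord_hom B n a).2 na).
  by apply: contraNneq aj => ->; rewrite horner0.
rewrite -[u]fiber_of_coordK; eexists; last by [].
apply: dga_hom_sum => j _.
have [->|/nu <-] := eqVneq (fiber_coord u 0 j) 0.
  by rewrite scale0r; exact: dga_hom0.
exact/dga_homZ/belt_hom.
Qed.

End FiberCoordinates.

(** * From rank inequalities to the surjection onto the fixed classes *)

Section Surjection.
Variables (k : fieldType) (A : dga {poly k}) (B : hom_basis A).
Variables (alpha : bidx B -> rat) (omega : k).
Hypothesis omegaP : (kummer_den alpha).-primitive_root omega.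
Hypothesis dP : d_preserves_kummer alpha.
Local Notation N := #|bidx B|.
Local Notation M eps := (map_mx (horner_eval eps) (basis_mx B (dga_d A))).

Lemma fiber_coord_d eps (u : fiber A eps) :
  fiber_coord B (fiber_d A eps u) = fiber_coord B u *m M eps.
Proof. exact: fiber_coord_map. Qed.

Lemma fiber_d_to_fiber eps (a : A) :
  fiber_d A eps (to_fiber eps a) = to_fiber eps (dga_d A a).
Proof. exact: fiber_mapE. Qed.

Lemma basis_mx_d_sqr eps : M eps *m M eps = 0.
Proof.
apply/row_matrixP => i; rewrite row0 rowE mulmxA.
rewrite -[delta_mx 0 i](@fiber_coordK _ _ B eps) -!fiber_coord_d.
set u := fiber_of_coord _ _; rewrite -[u]to_fiberK !fiber_d_to_fiber.
by rewrite dga_dd fiber_coordE coord_at0.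
Qed.

Definition monodromy (j : 'I_N) : k := omega ^ kummer_deg alpha (enum_val j).

Lemma fiber_coord_pl eps (u : fiber A eps) :
  fiber_coord B (fiber_pl alpha omega eps u) =
    fiber_coord B u *m diag_mx (\row_j monodromy j).
Proof.
rewrite -[u]to_fiberK [fiber_pl _ _ _ _]fiber_mapE !fiber_coordE.
apply/rowP => j; rewrite mul_mx_diag !mxE /= /pl.
have -> : \sum_i ((omega ^ kummer_deg alpha i)%:P * bcoord B (rep u) i) *: B i
    = \sum_i [ffun i => (omega ^ kummer_deg alpha i)%:P * bcoord B (rep u) i] i
        *: B i.
  by apply: eq_bigr => i _; rewrite ffunE.
by rewrite bcoord_lin ffunE hornerM hornerC mulrC.
Qed.

(* [fiber_pl] commutes with [fiber_d], so a nonzero entry of the matrix of the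
   differential links two basis elements with the same eigenvalue. *)
Lemma diag_monodromy_comm eps (phi : k -> k) :
  diag_mx (\row_j phi (monodromy j)) *m M eps =
    M eps *m diag_mx (\row_j phi (monodromy j)).
Proof.
have TM : diag_mx (\row_j monodromy j) *m M eps =
    M eps *m diag_mx (\row_j monodromy j).
  apply/row_matrixP => i; rewrite !rowE !mulmxA.
  rewrite -[delta_mx 0 i](@fiber_coordK _ _ B eps).
  by rewrite -fiber_coord_pl -!fiber_coord_d -fiber_coord_pl fiber_pl_d.
move: (map_mx _ _) TM => X TM; apply/matrixP => i j; move/matrixP/(_ i j): TM.
rewrite !mul_diag_mx !mul_mx_diag !mxE.
have [->|x0] := eqVneq (X i j) 0; first by rewrite !(mulr0, mul0r).
by rewrite [RHS]mulrC => /(mulIf x0) ->; rewrite mulrC.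
Qed.

(** The map is induced by [F] followed by the projector [Q] onto the eigenvalue 1 of [T], and
    [Q *m T = Q] puts its image among the fixed classes. A fixed class is fixed only up to a
    boundary on representatives; as [(T - 1) *m R = 1 - Q] and [R] commutes with the differential, a
    representative z nevertheless differs from z [Q] by a boundary, and z [Q] is reached from a
    cycle of the singular fiber. *)
Lemma surjects_of_rank eps :
  (forall n, \rank (degproj (@mdeg _ A B) k n *m M 0) <=
             \rank (degproj (@mdeg _ A B) k n *m M eps))%N ->
  surjects_onto_fixed omegaP dP eps.
Proof.
move=> le_rank.
have dh e : homog_mx (@mdeg _ A B) 1 (M e).
  exact/homog_mx_horner/basis_mx_d_homog.
have [F [hF MF cycF surF]] := graded_chain_surjection (dh 0) (dh eps)
  (basis_mx_d_sqr 0) (basis_mx_d_sqr eps) le_rank.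
pose T := diag_mx (\row_j monodromy j).
pose Q : 'M[k]_N := diag_mx (\row_j (monodromy j == 1)%:R).
(* [R] inverts [T - 1] off the eigenvalue 1, where the junk value [0^-1 = 0]
   makes it vanish. *)
pose R := diag_mx (\row_j (monodromy j - 1)^-1).
have QM : Q *m M eps = M eps *m Q.
  exact: (diag_monodromy_comm eps (fun t => (t == 1)%:R)).
have RM : R *m M eps = M eps *m R.
  exact: (diag_monodromy_comm eps (fun t => (t - 1)^-1)).
have QT : Q *m T = Q.
  apply/matrixP => i j; rewrite mul_diag_mx !mxE.
  have [->|] := eqVneq (monodromy i) 1; first by rewrite mul1r.
  by rewrite mul0r mul0rn.
have TR : (T - 1%:M) *m R = 1%:M - Q.
  apply/matrixP => i j; rewrite mul_mx_diag !mxE.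
  have [->|_] := eqVneq i j; last by rewrite !mulr0n !subr0 mul0r.
  rewrite !mulr1n; have [->|t1] := eqVneq (monodromy j) 1.
    by rewrite !subrr mul0r.
  by rewrite divff ?subr0 // subr_eq0.
pose f : {linear fiber A 0 -> fiber A eps} :=
  @fiber_of_coord k A B eps \o (mulmxr (F *m Q) \o @fiber_coord k A B 0).
have fE u : fiber_coord B (f u) = fiber_coord B u *m F *m Q.
  by rewrite /f /= fiber_coordK mulmxA.
have coord_eq0 e (u : fiber A e) : fiber_coord B u = 0 -> u = 0.
  by move=> u0; apply: (@fiber_coord_inj _ _ B); rewrite u0 linear0.
have cycM e (z : cycles (fiber_d A e)) : fiber_coord B (val z) *m M e = 0.
  by rewrite -fiber_coord_d; have /eqP -> := cycleP z; exact: linear0.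
have cyc_of e (v : 'rV[k]_N) : v *m M e = 0 ->
    exists z : cycles (fiber_d A e), fiber_coord B (val z) = v.
  move=> v0.
  have zP : @fiber_of_coord _ _ B e v \in cyc (fiber_d A e).
    rewrite unfold_in; apply/eqP/coord_eq0.
    by rewrite fiber_coord_d fiber_coordK.
  by exists (Cycles zP); exact: fiber_coordK.
have cls_coord e (z z' : cycles (fiber_d A e)) :
    (exists w, fiber_coord B (val z) - fiber_coord B (val z') = w *m M e) ->
    cls (bnd (fiber_d A e)) z = cls (bnd (fiber_d A e)) z'.
  move=> [w ew]; apply/cls_eq => /=; exists (@fiber_of_coord _ _ B e w).
  apply: (@fiber_coord_inj _ _ B); rewrite fiber_coord_d fiber_coordK -ew.
  by rewrite -[RHS]linearB.
have cls_coordV e (z z' : cycles (fiber_d A e)) :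
    cls (bnd (fiber_d A e)) z = cls (bnd (fiber_d A e)) z' ->
    exists w, fiber_coord B (val z) - fiber_coord B (val z') = w *m M e.
  move=> /cls_eq[w ew]; exists (fiber_coord B w).
  by rewrite -fiber_coord_d -ew -linearB.
have fcyc u : fiber_d A 0 u = 0 -> fiber_d A eps (f u) = 0.
  move=> u0; apply: coord_eq0; rewrite fiber_coord_d fE -(mulmxA _ Q) QM mulmxA.
  by rewrite cycF ?mul0mx // -fiber_coord_d u0 linear0.
have fbnd u : exists w, f (fiber_d A 0 u) = fiber_d A eps w.
  (* [F] sends boundaries to zero itself, so the primitive can be 0. *)
  exists 0; rewrite linear0; apply: coord_eq0.
  by rewrite fE fiber_coord_d -(mulmxA _ _ F) MF mulmx0 mul0mx.
have [phi phiE] := coh_functor fcyc fbnd.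
have phi_cls z : exists2 z', phi (cls (bnd (fiber_d A 0)) z) =
    cls (bnd (fiber_d A eps)) z' & val z' = f (val z).
  have zP : f (val z) \in cyc (fiber_d A eps).
    by have /eqP z0 := cycleP z; rewrite unfold_in; apply/eqP/fcyc.
  by exists (Cycles zP) => //; exact: phiE.
have plE z : coh_pl omegaP dP (cls (bnd (fiber_d A eps)) z) =
    cls (bnd (fiber_d A eps)) (cyc_map (fiber_pl_d omegaP dP (eps := eps)) z).
  exact: coh_mapE.
exists phi; split=> [n _ [z nz ->]|].
  have [z' -> z'E] := phi_cls z; exists z' => //.
  apply/(fiber_homE B) => j; rewrite z'E fE mul_mx_diag !mxE => sum0.
  have {sum0} : (fiber_coord B (val z) *m F) 0 j != 0.
    by apply: contraNneq sum0; rewrite mxE => ->; rewrite mul0r.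
  rewrite mxE => sum0.
  have [i zF] : exists i, fiber_coord B (val z) 0 i * F i j != 0.
    apply/existsP; apply: contraNT sum0; rewrite negb_exists => /forallP z0.
    by apply/eqP/big1 => i _; apply/eqP; have := z0 i; rewrite negbK.
  move: zF; rewrite mulf_eq0 negb_or => /andP[zi /hF ->].
  by rewrite addr0; exact: (fiber_homE B n (val z)).1 nz i zi.
apply/seteqP; split=> [_ [h _ <-]|h /=].
  rewrite -[h]repK; have [z' -> z'E] := phi_cls (rep h).
  rewrite /coh_fixed /= plE; congr cls; apply: val_inj => /=.
  apply: (@fiber_coord_inj _ _ B); rewrite fiber_coord_pl z'E fE.
  by rewrite -(mulmxA _ Q) QT.
rewrite /coh_fixed /= -[h]repK plE; set z := rep h.
move=> /cls_coordV[u]; rewrite /= fiber_coord_pl => uE.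
have [z0 [w [z0M zE]]] := surF _ (cycM _ z).
have [c cE] := cyc_of _ _ z0M.
exists (cls _ c) => //; have [z' -> z'E] := phi_cls c.
(* On coordinates z = z0 F + w M and z T - z = u M, with M the differential at [eps]. Applying [Q]
   to the first and [R] to the second yields z Q and z (1 - Q), whose sum is z; the total boundary
   term is (w Q + u R) M. *)
apply: cls_coord; rewrite z'E fE cE; exists (- (w *m Q + u *m R)).
have zQ : fiber_coord B (val z) *m Q = z0 *m F *m Q + w *m Q *m M eps.
  by rewrite zE mulmxDl -(mulmxA w) -QM mulmxA.
have zR : fiber_coord B (val z) *m (1%:M - Q) = u *m R *m M eps.
  by rewrite -TR mulmxA mulmxBr mulmx1 uE -(mulmxA _ _ R) -RM mulmxA.
have -> : fiber_coord B (val z) = z0 *m F *m Q + (w *m Q + u *m R) *m M eps.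
  by rewrite mulmxDl addrA -zQ -zR mulmxBr mulmx1 addrC subrK.
by rewrite mulNmx opprD addrA subrr sub0r.
Qed.

End Surjection.

(** * Laurent derivatives, exponents in characteristic 0, and generic rank *)

Lemma lpolyM_lfrac (k : fieldType) (p q : {poly k}) n :
  lpoly p * lfrac n q = lfrac n (p * q).
Proof. by apply: val_inj; rewrite /= tofracM mulrA. Qed.

Lemma lfracD (k : fieldType) (p q : {poly k}) n :
  lfrac n p + lfrac n q = lfrac n (p + q).
Proof. by apply: val_inj; rewrite /= tofracD mulrDl. Qed.

Lemma lderiv_lpoly (k : fieldType) (p : {poly k}) :
  lderiv (lpoly p) = lfrac 1 ('X * p^`()).
Proof.
have -> : lpoly p = lfrac 0 p by apply: val_inj; rewrite /= expr0 divr1.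
by rewrite lderivE /lfrac_deriv mul0r subr0.
Qed.

(** Comparing coefficients of x^m gives m = a - b in k, and characteristic 0 lifts this to the
    rationals. Hence at most one exponent occurs. In positive characteristic the exponents would be
    confined only to a residue class. *)
Lemma monomial_of_ode (k : fieldType) (a b : rat) (p : {poly k}) :
  [pchar k] =i pred0 -> 'X * p^`() = (ratr a - ratr b)%:P * p ->
  forall m, p`_m != 0 -> a = b + m%:R.
Proof.
move=> char0 E m pm.
have natr0 n : (n%:R == 0 :> k) = (n == 0)%N by apply: (pcharf0P k).1.
have intr0 (z : int) : (z%:~R == 0 :> k) = (z == 0).
  by case: z => n; rewrite ?NegzE ?rmorphN ?oppr_eq0 -?pmulrn natr0.
have : m%:R * p`_m = (ratr a - ratr b) * p`_m.
  rewrite -[RHS]coefCM -E coefXM; case: m {pm} => [|m]; first by rewrite mul0r.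
  by rewrite /= coef_deriv mulr_natl.
move/(mulIf pm); rewrite /ratr => e.
have da : (denq a)%:~R != 0 :> k by rewrite intr0 denq_neq0.
have db : (denq b)%:~R != 0 :> k by rewrite intr0 denq_neq0.
(* Denominators are cleared so that the identity can be pulled back along the injection of the
   integers into k. *)
have ez : numq a * denq b = numq b * denq a + m%:Z * (denq a * denq b).
  apply/eqP; rewrite -subr_eq0 -intr0 rmorphB rmorphD !rmorphM /= -pmulrn e.
  by apply/eqP; field; rewrite da db.
have da' : (denq a)%:~R != 0 :> rat by rewrite intr_eq0 denq_neq0.
have db' : (denq b)%:~R != 0 :> rat by rewrite intr_eq0 denq_neq0.
rewrite -(divq_num_den a) -(divq_num_den b).
apply: (mulIf (mulf_neq0 da' db')); rewrite mulrA divfK // -rmorphM ez.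
by rewrite rmorphD !rmorphM /= -pmulrn; field; rewrite db'.
Qed.

(** A single [q] serves all degrees: only the finitely many degrees of basis elements matter, and in
    any other degree the projector is zero. *)
Lemma rank_d_generic (k : fieldType) (A : dga {poly k}) (B : hom_basis A) :
  let M eps := map_mx (horner_eval eps) (basis_mx B (dga_d A)) in
  exists2 q : {poly k}, q != 0 & forall eps, ~~ root q eps -> forall n,
    (\rank (degproj (@mdeg _ A B) k n *m M 0%R) <=
     \rank (degproj (@mdeg _ A B) k n *m M eps))%N.
Proof.
move=> M; pose deg := @mdeg _ A B; pose Mx := basis_mx B (dga_d A).
have /choice[q qP] : forall n, exists q : {poly k}, q != 0 /\ forall eps,
    ~~ root q eps -> (\rank (degproj deg k n *m M 0%R) <=
                     \rank (degproj deg k n *m M eps))%N.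
  move=> n.
  have [q q0 qP] := mxrank_specialization (degproj deg {poly k} n *m Mx) 0.
  by exists q; split=> // eps /qP; rewrite !map_mxM !map_degproj.
exists (\prod_j q (deg j)).
  by rewrite prodf_seq_neq0; apply/allP => j _ /=; case: (qP (deg j)).
move=> eps qeps n; case: (pickP (fun j => deg j == n)) => [j /eqP <-|no_n].
  apply: (qP _).2; apply: contraNN qeps; rewrite /root horner_prod.
  by move=> qj; rewrite (bigD1 j) //= mulf_eq0 qj.
suff -> : degproj deg k n = 0 by rewrite !mul0mx.
by apply/matrixP => i j; rewrite !mxE no_n mul0rn.
Qed.

(** * The differential in a Kummer basis *)

Section KummerConnection.
Variables (k : fieldType) (A : dga {poly k}) (B : hom_basis A).
Variables (nabla : lext B -> lext B) (alpha : bidx B -> rat).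
Hypothesis nablaP : dg_mult_connection nabla.
Hypothesis alphaP : kummer_basis nabla alpha.

Lemma lextZE (f : laurent k) (u : lext B) j : (f *: u) j = f * u j.
Proof. by rewrite ffunE. Qed.

Lemma to_lextEj a j : to_lext B a j = lpoly (bcoord B a j).
Proof. by rewrite ffunE. Qed.

Lemma to_lext_belt i j : to_lext B (B i) j = (j == i)%:R.
Proof.
rewrite ffunE (bcoord_uniq (c := [ffun j => (j == i)%:R])).
  by rewrite ffunE; apply: val_inj; case: eqP => _ /=; rewrite ?tofrac1 ?tofrac0.
rewrite (bigD1 i) //= ffunE eqxx scale1r big1 ?addr0 // => l /negbTE li.
by rewrite ffunE li scale0r.
Qed.

Lemma to_lextE a : to_lext B a = \sum_j lpoly (bcoord B a j) *: to_lext B (B j).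
Proof.
apply/ffunP => i; rewrite sum_ffunE (bigD1 i) //= big1 => [|j /negbTE ji].
  by rewrite addr0 [RHS]ffunE to_lext_belt eqxx [LHS]ffunE [RHS]mulr1.
by rewrite ffunE to_lext_belt eq_sym ji; exact: mulr0.
Qed.

Lemma lext_dZ (f : laurent k) (u : lext B) : lext_d (f *: u) = f *: lext_d u.
Proof.
rewrite /lext_d scaler_sumr; apply: eq_bigr => i _.
by rewrite ffunE scalerA.
Qed.

Lemma lext_d_belt i : lext_d (to_lext B (B i)) = to_lext B (dga_d A (B i)).
Proof.
rewrite /lext_d (bigD1 i) //= to_lext_belt eqxx scale1r big1 ?addr0 // => j.
by move=> /negbTE ji; rewrite to_lext_belt ji scale0r.
Qed.

Lemma nablaD u v : nabla (u + v) = nabla u + nabla v.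
Proof.
have := connection_linear (dgmc_connection nablaP) 1 u v.
have -> : lpoly 1%:P = 1 :> laurent k by apply: val_inj; rewrite /= tofrac1.
by rewrite !scale1r.
Qed.

Lemma nabla_sum (F : bidx B -> lext B) : nabla (\sum_i F i) = \sum_i nabla (F i).
Proof.
apply: (big_morph nabla nablaD).
by apply: (addrI (nabla 0)); rewrite -nablaD !addr0.
Qed.

Lemma nabla_belt (f : laurent k) l j :
  nabla (f *: to_lext B (B l)) j =
    (f * lfrac 1 (ratr (alpha l))%:P + lderiv f) * (j == l)%:R.
Proof.
rewrite (connection_leibniz (dgmc_connection nablaP)) alphaP.
by rewrite scalerA -scalerDl lextZE to_lext_belt.
Qed.

(** Compare the coefficient of b_j in nabla (d b_i) = d (nabla b_i). The left side gives p' +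
    alpha_j p / x by the Leibniz rule, the right side alpha_i p / x. *)
Lemma kummer_ode i j : let p : {poly k} := bcoord B (dga_d A (B i)) j in
  'X * p^`() = (ratr (alpha i) - ratr (alpha j))%:P * p.
Proof.
move=> p; have := dgmc_d nablaP (to_lext B (B i)).
rewrite lext_d_belt alphaP lext_dZ lext_d_belt {1}to_lextE nabla_sum.
move/ffunP/(_ j); rewrite sum_ffunE (bigD1 j) //= big1 => [|l /negbTE lj].
  rewrite addr0 nabla_belt eqxx.
  rewrite [RHS]lextZE to_lextEj -/p mulr1 [RHS]mulrC !lpolyM_lfrac.
  rewrite lderiv_lpoly lfracD.
  have X0 : 'X^1 != 0 :> {poly k} by rewrite expr1 polyX_eq0.
  move=> /lfrac_eq /(mulfI X0) E.
  by rewrite rmorphB /= mulrBl ![_%:P * p]mulrC -E addrC addKr.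
by rewrite nabla_belt eq_sym lj mulr0.
Qed.

Local Notation M eps := (map_mx (horner_eval eps) (basis_mx B (dga_d A))).

(** The natural rescaling of b_j is by eps^alpha_j, which needs roots of [eps]. Floors replace it:
    where an entry is nonzero, alpha_i - alpha_j is its integer exponent, and the floors differ by
    the same integer. *)
Lemma basis_mx_d_scaling eps : [pchar k] =i pred0 -> eps != 0 ->
  let S := diag_mx (\row_j eps ^ Num.floor (alpha (enum_val j))) in
  M eps *m S = S *m M 1.
Proof.
move=> char0 eps0 S; apply/matrixP => i j.
rewrite mul_mx_diag mul_diag_mx !mxE /horner_eval.
have := monomial_of_ode char0 (kummer_ode (enum_val i) (enum_val j)).
move: (bcoord _ _ _) => p pE; rewrite !horner_coef mulr_suml mulr_sumr.
apply: eq_bigr => m _; rewrite expr1n mulr1.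
have [->|/pE ->] := eqVneq p`_m 0; first by rewrite !(mul0r, mulr0).
rewrite floorDrz ?natr_int // expfzDr // -[m%:R]/(m%:~R) intrKfloor -exprnP.
ring.
Qed.

(** The rescaling matrix is invertible and diagonal, so it commutes with [diag_mx w], and
    conjugating by it preserves the rank. Degree projectors are the case of interest. *)
Lemma rank_d_constant eps (w : 'rV[k]_#|bidx B|) :
  [pchar k] =i pred0 -> eps != 0 ->
  \rank (diag_mx w *m M eps) = \rank (diag_mx w *m M 1).
Proof.
move=> char0 eps0; have := basis_mx_d_scaling char0 eps0.
set s := \row_j _ => /= MS.
have Su : diag_mx s \in unitmx.
  rewrite unitmxE det_diag unitfE prodf_seq_neq0; apply/allP => j _ /=.
  by rewrite mxE expfz_neq0.
rewrite -(@mxrankMfree _ _ _ _ _ (diag_mx s)) ?row_free_unit //.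
rewrite -mulmxA MS mulmxA diag_mxC -mulmxA.
by rewrite eqmxMfull // row_full_unit.
Qed.

End KummerConnection.

Theorem corollary3p5p4 (k : fieldType) (k_infinite : infinite_set [set: k])
    (A : dga {poly k}) (B : hom_basis A)
    (nabla : lext B -> lext B) (nablaP : dg_mult_connection nabla)
    (alpha : bidx B -> rat) (alpha_le0 : forall i, alpha i <= 0)
    (alphaP : kummer_basis nabla alpha)
    (charD : (kummer_den alpha)%:R != 0 :> k)
    (omega : k) (omegaP : (kummer_den alpha).-primitive_root omega)
    (dP : d_preserves_kummer alpha)
    (coreP : core_homogeneous alpha) :
  finite_set [set eps : k | eps != 0 /\ ~ surjects_onto_fixed omegaP dP eps] /\
  ([pchar k] =i pred0 ->
     forall eps : k, eps != 0 -> surjects_onto_fixed omegaP dP eps).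
Proof.
have [q q0 qP] := rank_d_generic B.
split=> [|char0 eps eps0].
  (* Every exceptional [eps] is a root of [q]. *)
  apply: sub_finite_set (finite_root_set q0) => eps /= [_ nsurj].
  apply: contrapT => /negP qeps; apply: nsurj.
  exact/surjects_of_rank/qP.
(* In characteristic 0 a given nonzero [eps] may be a root of [q], so an auxiliary generic point [e]
   is chosen; the factor ['X] keeps it away from 0. The ranks at [eps] and at [e] both equal those
   at 1. *)
have [e [e0 qe]] : exists e, e != 0 /\ ~~ root q e.
  have qX0 : q * 'X != 0 by rewrite mulf_neq0 // polyX_eq0.
  have := infinite_setD k_infinite (finite_root_set qX0).
  move=> /infinite_setN0[e [_ /= /negP]].
  by rewrite rootM rootX negb_or => /andP[qe e0]; exists e.
apply: surjects_of_rank => n.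
rewrite (rank_d_constant nablaP alphaP _ char0 eps0).
by rewrite -(rank_d_constant nablaP alphaP _ char0 e0); exact: qP.
Qed.
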